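(* There is a compact Haar-finite subset of $\mathbb{R}$ which is not Haar-$n$ for any $n\in\omega$.
   Context: $\omega=\{0,1,2,\ldots\}$. A Cantor set is a homeomorphic copy of $2^\omega$. A set $A\subseteq\mathbb{R}$ is Haar-finite (respectively Haar-$n$) if there are a Borel set $B\subseteq\mathbb{R}$ with $A\subseteq B$ and a Cantor set $C\subseteq\mathbb{R}$ such that for all $x\in\mathbb{R}$ the set $(C+x)\cap B$ is finite (respectively, has cardinality at most $n$). *)

(* Defs.v *)
From HB Require Import structures.
From mathcomp Require Import all_boot all_order all_algebra.
From mathcomp Require Import all_classical all_reals all_analysis.

Set Implicit Arguments.
Unset Strict Implicit.
Unset Printing Implicit Defensive.

Import Order.TTheory GRing.Theory Num.Theory.
Import numFieldNormedType.Exports.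

Local Open Scope classical_set_scope.
Local Open Scope ring_scope.
Local Open Scope card_scope.

Definition borel (T : topologicalType) : set (set T) := <<s @open T >>.

(* The homeomorphism and its inverse are given as total functions; only the
   restriction of [g] to [C], with the subspace topology, matters. *)
Definition cantor_set (T : topologicalType) (C : set T) : Prop :=
  exists (f : cantor_space -> T) (g : T -> cantor_space),
    [/\ continuous f, range f = C, cancel f g & {within C, continuous g}].

Definition translate (R : zmodType) (C : set R) (x : R) : set R :=
  [set c + x | c in C].

Definition haar_finite (R : realType) (A : set R) : Prop :=
  exists B C : set R,
    [/\ borel B, A `<=` B, cantor_set C &
        forall x : R, finite_set (translate C x `&` B)].

Definition haar_n (R : realType) (n : nat) (A : set R) : Prop :=
  exists B C : set R,
    [/\ borel B, A `<=` B, cantor_set C &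
        forall x : R, (translate C x `&` B) #<= `I_n].

(* Main.v *)
Require Import Defs.
From mathcomp Require Import all_boot all_order all_algebra.
From mathcomp Require Import all_classical all_reals all_analysis.
From mathcomp Require Import ring lra zify.
Import Order.TTheory GRing.Theory Num.Theory.
Import numFieldNormedType.Exports.

Local Open Scope classical_set_scope.
Local Open Scope ring_scope.
Local Open Scope card_scope.

(* Fix rapidly growing integers q_0 | q_1 | ... (scale) and let A_n (piece n)
   consist of the x in [1/(3 q_2n), 2/(3 q_2n)] such that q_i x is at distance
   at least 1/(4(n+2)) from the integers for all i > 2n.  The A_n shrink to 0,
   and A is the union of {0} and all the A_n.

   Any n+1 points of small diameter have a common translate in A_n: in an
   interval of length 1/q_i take n+2 equally spaced candidates; each of the
   n+1 points spoils at most one of them, and a surviving candidate leaves room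
   for an interval of length 1/q_(i+1).  Hence A is not Haar-n.

   For Haar-finiteness, let C be the set of the sums of the digit_i(s)/(base_i
   q_i), s in 2^omega, where the digits run through all functions of finitely
   many coordinates of s.  Given 8(n+2) distinct points of C, some q_i maps them
   modulo 1 almost onto the multiples of 1/(8(n+2)), so that no translate of
   these points lies in A_n: every translate of C has fewer than 8(n+2) points
   in A_n.  If a translate C + x meets infinitely many A_n, then 0 is in C + x,
   so C - C meets some A_n; but all even digits are 0, which makes
   q_2n (C - C) close to the integers. *)

(** * Digits, scales and the expansion of points of the Cantor set *)

(* Even indices carry the empty pattern, which yields the digit 0 in base 1. *)
Definition pattern (i : nat) : nat * seq (seq bool) :=
  if odd i then odflt (0%N, [::]) (unpickle i./2) else (0%N, [::]).

Definition base (i : nat) : nat := (size (pattern i).2).+1.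

(* Prefixes not listed in the pattern all get the largest digit, [size _]. *)
Definition digit (i : nat) (s : nat -> bool) : nat :=
  index (mkseq s (pattern i).1) (pattern i).2.

(** The factor [base j] clears the denominator of the [j]-th term of the sum. The factor [16 * j.+1]
    keeps the tail small against [1 / base j] and outgrows the constants [4 * n.+2] and [12] needed
    to nest intervals. *)
Fixpoint scale (i : nat) : nat :=
  if i is j.+1 then (scale j * (16 * j.+1 * base j))%N else 1%N.

Definition psum (R : realType) (N : nat) (s : nat -> bool) : R :=
  \sum_(i < N) (digit i s)%:R / ((base i)%:R * (scale i)%:R).

(** All terms are nonnegative, so the supremum of the partial sums is the sum of the series. *)
Definition cantor_emb (R : realType) (s : nat -> bool) : R :=
  sup (range (fun N => psum R N s)).

Lemma digit_lt i s : (digit i s < base i)%N.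
Proof. by rewrite ltnS index_size. Qed.

Lemma base_even n : base n.*2 = 1%N.
Proof. by rewrite /base /pattern odd_double. Qed.

Lemma scale_gt0 i : (0 < scale i)%N.
Proof. by elim: i => //= i IH; rewrite !muln_gt0 IH. Qed.

Lemma scaleS (R : realType) i :
  (scale i.+1)%:R = (scale i)%:R * (16 * i.+1%:R * (base i)%:R) :> R.
Proof. by rewrite /= !natrM. Qed.

Lemma scaler_gt0 (R : realType) i : 0 < (scale i)%:R :> R.
Proof. by rewrite ltr0n scale_gt0. Qed.

Lemma leq_scaleS c i : (c <= 16 * i.+1)%N -> (c * scale i <= scale i.+1)%N.
Proof.
move=> ci; rewrite /= [leqRHS]mulnC leq_mul2r; apply/orP; right.
by apply: leq_trans ci _; rewrite leq_pmulr.
Qed.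

Lemma scale_ge i : (i < scale i)%N.
Proof.
elim: i => // i IH; have := leq_scaleS 2 i ltac:(lia); lia.
Qed.

Lemma scale_mono i j : (i <= j)%N -> (scale i <= scale j)%N.
Proof.
move=> /subnK <-; elim: (j - i)%N => // k IH.
by apply: leq_trans IH _; have := leq_scaleS 1 (k + i)%N ltac:(lia); rewrite mul1n.
Qed.

Lemma psumS (R : realType) N s : psum R N.+1 s =
  psum R N s + (digit N s)%:R / ((base N)%:R * (scale N)%:R).
Proof. by rewrite /psum big_ord_recr. Qed.

(** For [j < i], the denominator [base j * scale j] divides [scale j.+1], hence [scale i]. *)
Lemma psum_scale_int (R : realType) i s :
  exists m : nat, (scale i)%:R * psum R i s = m%:R.
Proof.
elim: i => [|i [m IH]]; first by exists 0%N; rewrite /psum big_ord0 mulr0.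
exists (16 * i.+1 * base i * m + 16 * i.+1 * digit i s)%N.
rewrite psumS scaleS natrD !natrM -IH.
have := scaler_gt0 R i; have : 0 < (base i)%:R :> R by rewrite ltr0n.
move: (psum _ _ _) (base i)%:R (scale i)%:R (digit i s)%:R => x b c d b0 c0.
by field; rewrite !gt_eqF.
Qed.

Lemma psum_le (R : realType) i N s : (i <= N)%N -> psum R i s <= psum R N s.
Proof.
move=> /subnK <-; elim: (N - i)%N => // k IH.
by apply: le_trans IH _; rewrite addSn psumS lerDl divr_ge0 ?mulr_ge0.
Qed.

(** Each term is at most [1 / scale i] and the scales at least double, so a monotone upper bound for
    the series arises, with tail at most [2 / scale i]. *)
Lemma psum_bound (R : realType) i N s : (i <= N)%N ->
  psum R N s + 2 / (scale N)%:R <= psum R i s + 2 / (scale i)%:R.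
Proof.
move=> /subnK <-; elim: (N - i)%N => // k IH; apply: le_trans IH.
rewrite addSn; move: (k + i)%N => {k}i; rewrite psumS.
have c0 := scaler_gt0 R i; have b1 : 1 <= (base i)%:R :> R by rewrite ler1n.
have c1 := scaler_gt0 R i.+1.
have cc : 2 * (scale i)%:R <= (scale i.+1)%:R :> R.
  by rewrite -natrM ler_nat leq_scaleS //; lia.
have db : (digit i s)%:R <= (base i)%:R :> R by rewrite ler_nat ltnW// digit_lt.
have h1 : (digit i s)%:R / ((base i)%:R * (scale i)%:R) <= 1 / (scale i)%:R :> R.
  rewrite ler_pdivrMr ?mulr_gt0//.
  by rewrite mulrCA mul1r mulVf ?mulr1 // gt_eqF.
have h2 : 2 / (scale i.+1)%:R <= 1 / (scale i)%:R :> R.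
  by rewrite ler_pdivrMr// mulrAC ler_pdivlMr// mul1r.
lra.
Qed.

Lemma cantor_emb_bounds (R : realType) i s :
  psum R i s <= cantor_emb R s <= psum R i s + 2 / (scale i)%:R.
Proof.
have ub : ubound (range (fun N => psum R N s)) (psum R i s + 2 / (scale i)%:R).
  move=> _ [N _ <-].
  apply: (le_trans (@psum_le R N (maxn i N) s (leq_maxr _ _))).
  apply: le_trans (@psum_bound R i (maxn i N) s (leq_maxl _ _)).
  by rewrite lerDl divr_ge0.
apply/andP; split.
  apply: ub_le_sup; last by exists i.
  by exists (psum R i s + 2 / (scale i)%:R).
by apply: ge_sup => //; exists (psum R 0 s), 0%N.
Qed.

(** After scaling, the terms before [i] give the integer [m], the term at [i] gives the digit, and
    the tail gives [e]. *)
Lemma cantor_emb_digit (R : realType) i s : exists (m : int) (e : R),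
  [/\ 0 <= e, 8 * (base i)%:R * e <= 1 &
    (scale i)%:R * cantor_emb R s = m%:~R + (digit i s)%:R / (base i)%:R + e].
Proof.
have [m hm] := psum_scale_int R i s.
exists m, ((scale i)%:R * (cantor_emb R s - psum R i.+1 s)).
have /andP[f1 f2] := cantor_emb_bounds R i.+1 s.
have c0 := scaler_gt0 R i; have b0 : 0 < (base i)%:R :> R by rewrite ltr0n.
split; first by rewrite mulr_ge0 ?subr_ge0 // ltW.
  have : (scale i)%:R * (cantor_emb R s - psum R i.+1 s) <=
      (scale i)%:R * (2 / (scale i.+1)%:R) by rewrite ler_pM2l// lerBlDl.
  rewrite scaleS => h.
  have i1 : 1 <= i.+1%:R :> R by rewrite ler1n.
  have E : (scale i)%:R * (2 / ((scale i)%:R * (16 * i.+1%:R * (base i)%:R))) =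
    1 / (8 * (base i)%:R) * (i.+1%:R)^-1 :> R.
    by field; rewrite !gt_eqF// addrC natr1 ltr0n.
  rewrite E in h.
  have h' : (scale i)%:R * (cantor_emb R s - psum R i.+1 s) <= 1 / (8 * (base i)%:R).
    apply: le_trans h _; rewrite ger_pMr ?divr_gt0 ?mulr_gt0//.
    by rewrite invf_le1 ?ltr0n.
  by move: h'; rewrite ler_pdivlMr ?mulr_gt0// mulrC.
have -> : (m%:Z)%:~R = m%:R :> R by [].
rewrite -hm psumS; move: (psum _ _ _) (cantor_emb _ _) (digit i s)%:R => x y d.
by field; rewrite !gt_eqF.
Qed.

(** * Realization of prescribed digits, and injectivity *)

Lemma nat_inj_unbounded (f : nat -> nat) (n : nat) :
  injective f -> exists m, (n <= f m)%N.
Proof.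
move=> finj; apply: contrapT => /forallNP h.
have lt_fn m : (f m < n)%N by rewrite ltnNge; apply/negP/h.
pose g (i : 'I_n.+1) : 'I_n := Ordinal (lt_fn i).
have /leq_card : injective g by move=> i j /(congr1 val)/finj/val_inj.
by rewrite !card_ord ltnn.
Qed.

Lemma prefixes_uniq (K : nat) (u : nat -> nat -> bool) :
  {in iota 0 K &, injective u} ->
  exists m0, forall m, (m0 <= m)%N -> uniq (mkseq (fun j => mkseq (u j) m) K).
Proof.
move=> uinj.
have sep (i j : nat) : exists d, (i < K)%N -> (j < K)%N -> i != j -> u i d != u j d.
  apply: contrapT => /forallNP h.
  have iK : (i < K)%N by apply: contrapT => C; apply: (h 0%N) => /C.
  have jK : (j < K)%N by apply: contrapT => C; apply: (h 0%N) => _ /C.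
  have ij : i != j by apply: contrapT => C; apply: (h 0%N) => _ _ /C.
  have /eqP := ij; apply; apply: uinj; rewrite ?mem_iota//.
  apply/funext => d; apply: contrapT => C; apply: (h d) => _ _ _.
  exact/eqP.
have /choice[d hd] : forall p : nat * nat, exists d,
    (p.1 < K)%N -> (p.2 < K)%N -> p.1 != p.2 -> u p.1 d != u p.2 d.
  by move=> p; exact: sep.
(* The prefixes must reach past every coordinate chosen to separate a pair. *)
exists (\max_(i < K) \max_(j < K) (d (nat_of_ord i, nat_of_ord j)).+1)%N => m hm.
rewrite map_inj_in_uniq ?iota_uniq// => i j; rewrite !mem_iota !add0n /= => iK jK E.
apply: contrapT => /eqP ij; have /= := hd (i, j) iK jK ij; apply/negP; rewrite negbK.
have dm : (d (i, j) < m)%N.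
  apply: leq_trans hm.
  apply: leq_trans (leq_bigmax (Ordinal iK)).
  exact: (leq_bigmax (Ordinal jK)).
by have := congr1 (fun w => nth false w (d (i, j))) E; rewrite !nth_mkseq// => ->.
Qed.

(** A pattern listing long prefixes of [u 0], ..., [u (K-1)] in this order gives each its index as
    digit; [u K] is not listed and gets the default digit [K]. *)
Lemma digits_realized (K i0 : nat) (u : nat -> nat -> bool) :
  {in iota 0 K.+1 &, injective u} ->
  exists i, [/\ (i0 <= i)%N, base i = K.+1 &
    forall j, (j <= K)%N -> digit i (u j) = j].
Proof.
move=> uinj; have [m0 um] := prefixes_uniq _ _ uinj.
pose P m : nat * seq (seq bool) := (m, mkseq (fun j => mkseq (u j) m) K).
(* Lengthening the prefixes yields infinitely many patterns, so their codes are unbounded. *)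
have [k hk] : exists k, (i0 <= pickle (P (m0 + k)%N))%N.
  apply: nat_inj_unbounded => a b /(pcan_inj pickleK)[+ _].
  exact: addnI.
exists (pickle (P (m0 + k)%N)).*2.+1.
have pE : pattern (pickle (P (m0 + k)%N)).*2.+1 = P (m0 + k)%N.
  by rewrite /pattern /= odd_double /= uphalf_double pickleK.
split; first by rewrite -addnn; lia.
  by rewrite /base pE size_mkseq.
move=> j jK; rewrite /digit pE /=.
have := um (m0 + k)%N (leq_addr _ _); rewrite -[mkseq _ K.+1]/(map _ _) -addn1 iotaD map_cat.
rewrite cats1 rcons_uniq -/(mkseq _ _) add0n => /andP[nin un].
move: jK; rewrite leq_eqVlt => /predU1P[->|jK].
  by rewrite memNindex ?size_mkseq.
by rewrite -{1}(@nth_mkseq _ [::] (fun j => mkseq (u j) (m0 + k)) K j)// index_uniq// size_mkseq.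
Qed.

(** Distinct sequences have digits 0 and 1 at some index of base 2, so their scaled images differ by
    1/2 modulo 1, up to an error of at most 1/16. *)
Lemma cantor_emb_inj (R : realType) : injective (cantor_emb R).
Proof.
move=> s s' E; apply: contrapT => ss'.
pose u (j : nat) := if j is 0%N then s else s'.
have [|i [_ bi hd]] := @digits_realized 1 0 u.
  by move=> [|[|a]] [|[|b]]; rewrite ?mem_iota //= => _ _ h; case: ss'; move: h => /= ->.
have [m [e [e0 e1 h]]] := cantor_emb_digit R i s.
have [m' [e' [e'0 e'1 h']]] := cantor_emb_digit R i s'.
have := hd 0%N isT; have := hd 1%N isT; rewrite /= => d1 d0.
move: h h' e1 e'1; rewrite E bi d1 d0 => -> h' e1 e'1.
have H : (m - m')%:~R = 1 / 2 + e' - e :> R by rewrite intrB; lra.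
have : 0 < (m - m')%:~R :> R by lra.
have : (m - m')%:~R < 1%:~R :> R by lra.
by rewrite ltr_int -[0]/(0%:~R) ltr_int; lia.
Qed.

(** * Topology of the Cantor space and of its images *)

Lemma near_coord (s : cantor_space) (j : nat) :
  \forall s' \near s, s' j = s j.
Proof.
have /(_ [set s j]) := @proj_continuous nat (fun=> bool) j s.
by apply; exact: discrete_set1.
Qed.

Lemma near_prefix (s : cantor_space) (m : nat) :
  \forall s' \near s, forall j, (j < m)%N -> s' j = s j.
Proof.
elim: m => [|m IH]; first by apply: filterE => s' j; rewrite ltn0.
apply: filterS2 (near_coord s m) IH => s' sm IH j; rewrite ltnS leq_eqVlt.
by move=> /predU1P[->|/IH].
Qed.

Lemma psum_locally_constant (R : realType) (N : nat) (s : cantor_space) :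
  \forall s' \near s, psum R N s' = psum R N s.
Proof.
apply: filterS (near_prefix s (\max_(i < N) (pattern i).1)) => s' h.
rewrite /psum; apply: eq_bigr => i _; congr (_%:R / _).
rewrite /digit; congr index; apply/eq_in_map => j; rewrite mem_iota add0n => /= jm.
by apply: h; apply: leq_trans jm (leq_bigmax i).
Qed.

Lemma cantor_emb_continuous (R : realType) :
  continuous (cantor_emb R : cantor_space -> R).
Proof.
move=> s; apply/cvgrPdist_lt => e e0.
pose N := Num.truncn (2 / e).
have Ne : 2 / (scale N.+1)%:R < e.
  rewrite ltr_pdivrMr ?scaler_gt0// mulrC -ltr_pdivrMr//.
  apply: lt_trans (truncnS_gt _) _; rewrite ltr_nat; exact: scale_ge.
apply: filterS (psum_locally_constant R N.+1 s) => s' E.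
have /andP[a1 a2] := cantor_emb_bounds R N.+1 s.
have /andP[b1 b2] := cantor_emb_bounds R N.+1 s'.
rewrite E in b1 b2.
by rewrite ltr_norml; apply/andP; split; lra.
Qed.

(** A closed set of sequences is compact, so its image is compact and, in a Hausdorff space, closed;
    this makes the inverse continuous on the range. *)
Lemma cantor_set_range (T : topologicalType) (f : cantor_space -> T) :
  hausdorff_space T -> continuous f -> injective f -> cantor_set (range f).
Proof.
move=> hT cf injf; pose g t := xget point [set s | f s = t].
have fK : cancel f g.
  move=> s; apply: injf; rewrite /g; case: xgetP => [s' _ //|/(_ s)].
  by case.
exists f, g; split => //.
apply/continuous_closedP => K cK; apply/closed_subspaceP; exists (f @` K).
  apply: compact_closed => //; apply: continuous_compact.
    exact: continuous_subspaceT.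
  exact: (subclosed_compact cK cantor_space_compact).
apply/seteqP; split => t [Kt [s _ fst]]; move: Kt; rewrite -fst => {t fst}.
  by move=> [s0 Ks0 /injf <-]; split; [rewrite -(fK s0) in Ks0|exists s0].
by rewrite -[X in X -> _]/(K (g (f s))) fK => Ks; split; exists s.
Qed.

Lemma cantor_space_accumulation (T : topologicalType) (f : cantor_space -> T)
    (s : cantor_space) (U : set T) :
  {for s, continuous f} -> injective f -> nbhs (f s) U ->
  exists z : nat -> T, injective z /\ forall j, range f (z j) /\ U (z j).
Proof.
move=> cf injf /cf nU.
(* [u j] flips coordinate [j] of [s]: these points are distinct and converge to [s]. *)
pose u j : cantor_space := fun d => (d == j) (+) s d.
have uinj : injective u.
  move=> i j /(congr1 (fun h : cantor_space => h i)).
  by rewrite /u eqxx; case: (i =P j) => // _; case: (s i).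
have us : u @ \oo --> s.
  apply/cvg_sup => d; apply/cvg_image.
    by apply/seteqP; split => // b _; exists (fun=> b).
  move=> V /= /nbhs_singleton Vsd.
  exists (@^~ d @^-1` V); last first.
    by apply/seteqP; split => [_ [h ? <-]//|b Vb]; exists (fun=> b).
  exists d.+1 => // j /= dj; rewrite /u.
  by rewrite (_ : d == j = false) ?addFb//; apply/eqP => E; move: dj; rewrite /= E ltnn.
have [M _ hM] := us _ nU.
exists (fun j => f (u (M + j)%N)); split.
  by move=> i j /injf/uinj/addnI.
move=> j; split; first by exists (u (M + j)%N).
by apply: hM; rewrite /= leq_addr.
Qed.

(** * The pieces contain translates of all small sets of [n.+1] points *)

Definition piece (R : realType) (n : nat) : set R :=
  [set x | 1 <= 3 * (scale n.*2)%:R * x <= 2 /\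
     forall i (m : int), (n.*2 < i)%N ->
       1 <= 4 * n.+2%:R * `|(scale i)%:R * x - m%:~R|].

Lemma subinterval_avoiding (R : realType) (n : nat) (t : nat -> R) (Q y : R) :
  0 < Q -> exists y', [/\ y <= y', y' + 1 / (4 * n.+2%:R * Q) <= y + 1 / Q &
    forall x j (m : int), y' <= x <= y' + 1 / (4 * n.+2%:R * Q) ->
      (j <= n)%N -> 1 <= 4 * n.+2%:R * `|Q * (x + t j) - m%:~R|].
Proof.
move=> Q0; set M : R := n.+2%:R.
have M2 : 2 <= M by rewrite ler_nat.
pose cand (l : 'I_n.+2) : R := y + l%:R / (M * Q).
have Q'0 : 0 < 1 / Q by rewrite divr_gt0.
have candlast l : cand l + 1 / (4 * M * Q) <= y + 1 / Q.
  have : l%:R + 1 <= M by rewrite natr1 ler_nat.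
  rewrite /cand => lM; rewrite -addrA lerD2l.
  have -> : l%:R / (M * Q) + 1 / (4 * M * Q) = (l%:R + 4^-1) / M * (1 / Q).
    by field; rewrite !gt_eqF//; lra.
  rewrite ger_pMl// ler_pdivrMr; lra.
(* Otherwise every candidate is spoiled by some [t j], and by pigeonhole two
   candidates are spoiled by the same one. *)
apply: contrapT => /forallNP bad.
have killed (l : 'I_n.+2) : exists j : 'I_n.+1, exists m : int,
    2 * M * `|Q * (y + t j) + l%:R / M - m%:~R| < 1.
  apply: contrapT => /forallNP good; apply: (bad (cand l)); split => //.
    by rewrite /cand lerDl divr_ge0// mulr_ge0//; lra.
  move=> x j m /andP[x1 x2] jn; have jn' : (j < n.+1)%N by [].
  have {good}/forallNP/(_ m)/negP := good (Ordinal jn').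
  rewrite -leNgt /= => h.
  (* At an unspoiled candidate the distance to the integers is at least [1 / (2 * M)]; moving right
     by [d / Q] costs at most half of it. *)
  pose d := Q * (x - cand l).
  have d0 : 0 <= d by rewrite mulr_ge0 ?subr_ge0// ltW.
  have d1 : 4 * M * d <= 1.
    have : Q * (x - cand l) <= Q * (1 / (4 * M * Q)).
      by rewrite ler_pM2l// lerBlDl.
    have -> : Q * (1 / (4 * M * Q)) = 1 / (4 * M) by field; rewrite !gt_eqF//; lra.
    rewrite ler_pdivlMr; last lra.
    by rewrite mulrC.
  have E : Q * (x + t j) - m%:~R = (Q * (y + t j) + l%:R / M - m%:~R) + d.
    by rewrite /d /cand; field; rewrite !gt_eqF//; lra.
  rewrite E; move: h; set a := (X in `|X|) => h.
  have tri : `|a| <= `|a + d| + d.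
    by rewrite -{1}(addrK d a) (le_trans (ler_normB _ _))// (ger0_norm d0).
  have : 4 * M * `|a| <= 4 * M * (`|a + d| + d) by rewrite ler_pM2l//; lra.
  lra.
have [j hj] := choice killed.
suff /leq_card : injective j by rewrite !card_ord ltnn.
move=> l l' jl; apply/val_inj => /=.
have [m hm] := hj l; have [m' hm'] := hj l'; rewrite -jl in hm'.
move: hm hm'; set c := Q * _ => hm hm'.
have MN0 : M != 0 by rewrite gt_eqF//; lra.
(* Both values are within [1 / (2 * M)] of integers, so [(l - l') / M] is less than [1 / M] away
   from an integer; hence [l] and [l'] agree modulo [n.+2]. *)
have : `|((l%:Z - l'%:Z) - n.+2%:Z * (m - m'))%:~R| < 1 :> R.
  rewrite !(intrB, intrM) /=.
  set b := (X in `|X|).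
  have -> : b = M * ((c + l%:R / M - m%:~R) - (c + l'%:R / M - m'%:~R)).
    by rewrite /b -/M; field.
  rewrite normrM (ger0_norm (_ : 0 <= M)); last lra.
  have := ler_normB (c + l%:R / M - m%:~R) (c + l'%:R / M - m'%:~R).
  rewrite -(@ler_pM2l _ M); lra.
rewrite -intr_norm -[1]/(1%:~R) ltr_int => h.
have {h}E : l%:Z - l'%:Z = n.+2%:Z * (m - m') by lia.
have lM := ltn_ord l; have l'M := ltn_ord l'.
have [d0|d0|d0] := ltgtP (m - m') 0; nia.
Qed.

(** Iterating [subinterval_avoiding] gives nested intervals [[y i, y i + 1 / q i]], each good for
    one scale; their common point [x] is good for all. *)
Lemma piece_universal (R : realType) (n : nat) (t : nat -> R) :
  (forall j, 12 * (scale n.*2)%:R * `|t j| <= 1) ->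
  exists x, forall j, (j <= n)%N -> piece R n (x + t j).
Proof.
move=> tsmall; pose q i : R := (scale (n.*2.+1 + i))%:R.
have q0 i : 0 < q i by exact: scaler_gt0.
have qS i : 4 * n.+2%:R * q i <= q i.+1.
  rewrite -!natrM ler_nat addnS leq_scaleS //; lia.
have /choice[step hstep] : forall p : nat * R, exists y',
   [/\ p.2 <= y', y' + 1 / q p.1.+1 <= p.2 + 1 / q p.1 &
    forall x j (m : int), y' <= x <= y' + 1 / q p.1.+1 ->
      (j <= n)%N -> 1 <= 4 * n.+2%:R * `|q p.1 * (x + t j) - m%:~R|].
  move=> [i y] /=; have [y' [y1 y2 hy']] := subinterval_avoiding R n t (q i) y (q0 i).
  have le1 : 1 / q i.+1 <= 1 / (4 * n.+2%:R * q i).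
    by rewrite !div1r lef_pV2 ?posrE ?mulr_gt0.
  exists y'; split => //; first by apply: le_trans y2; rewrite lerD2l.
  move=> x j m /andP[x1 x2]; apply: hy'; rewrite x1 (le_trans x2)//.
  by rewrite lerD2l.
(* The start is the midpoint of the range allowed in [piece]. The margin [1 / (6 * scale n.*2)] on
   either side absorbs both the first interval and [t j], each at most half of it. *)
pose y := fix y i : R := if i is k.+1 then step (k, y k) else 1 / (2 * (scale n.*2)%:R).
have ymono i k : y i <= y (k + i)%N.
  elim: k => // k IH; apply: le_trans IH _.
  by rewrite addSn; have [] := hstep ((k + i)%N, y (k + i)%N).
have ytop i k : y (k + i)%N + 1 / q (k + i)%N <= y i + 1 / q i.
  elim: k => // k; apply: le_trans.
  by rewrite addSn; have [_ + _] := hstep ((k + i)%N, y (k + i)%N).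
have yub i k : y k <= y i + 1 / q i.
  have := ymono k i; have := ytop i k; rewrite addnC => h h'.
  apply: le_trans h' _; apply: le_trans h; rewrite lerDl divr_ge0 //; exact: ltW.
pose x := sup (range y).
have xle i : x <= y i + 1 / q i.
  by apply: ge_sup => [|_ [k _ <-]//]; exists (y 0%N), 0%N.
have lex i : y i <= x.
  apply: ub_le_sup; last by exists i.
  by exists (y 0%N + 1 / q 0%N) => _ [k _ <-].
exists x => j jn; split.
  have := lex 0%N; have := xle 0%N; have := tsmall j.
  have : 12 * (scale n.*2)%:R <= q 0%N.
    rewrite /q addn0 -natrM ler_nat leq_scaleS //; lia.
  have s0 := scaler_gt0 R n.*2; rewrite /=; move: s0 (q0 0%N).
  move: (scale _)%:R (q 0%N) (t j) => s Q tj s0 Q0 sQ tj1 h1 h2.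
  have t1 := ler_norm tj; have t2 := ler_norm (- tj); rewrite normrN in t2.
  have := ler_wpM2l (ltW s0) t1; have := ler_wpM2l (ltW s0) t2 => t3 t4.
  have e1 : 1 <= 2 * s * x.
    by move: h2; rewrite ler_pdivrMr ?mulr_gt0// mulrC.
  have e2 : 2 * s * x <= 1 + 6^-1.
    have : 2 * s * x <= 2 * s * (1 / (2 * s) + 1 / Q) by rewrite ler_pM2l ?mulr_gt0.
    have -> : 2 * s * (1 / (2 * s) + 1 / Q) = 1 + 6^-1 * (12 * s / Q).
      by field; rewrite !gt_eqF.
    have : 12 * s / Q <= 1 by rewrite ler_pdivrMr ?mul1r.
    lra.
  by apply/andP; split; lra.
move=> i m ni; rewrite -(subnKC ni).
have [_ _ good] := hstep ((i - n.*2.+1)%N, y (i - n.*2.+1)%N).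
by apply: good => //; rewrite (lex (i - n.*2.+1).+1) (xle (i - n.*2.+1).+1).
Qed.

(** * Compactness of the union of the pieces and 0 *)

(* This is {0} together with all the pieces, in a form that is visibly closed. *)
Definition pieces (R : realType) : set R :=
  \bigcap_(N in [set: nat]) ((\bigcup_(n in `I_N) piece R n) `|`
    [set x | 0 <= x /\ 3 * (scale N.*2)%:R * x <= 2]).

Lemma closed_preimage_le (R : realType) (f : R -> R) (a : R) :
  continuous f -> closed [set x | a <= f x].
Proof. by move=> cf; exact: (continuous_closedP f).1 cf _ (@closed_ge R a). Qed.

Lemma piece_closed (R : realType) (n : nat) : closed (piece R n).
Proof.
(* Every condition takes the form [a <= f x] with [f] continuous. *)
have -> : piece R n = [set x | 1 <= 3 * (scale n.*2)%:R * x] `&`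
    [set x | - 2 <= - (3 * (scale n.*2)%:R * x)] `&`
    \bigcap_(i in [set i | (n.*2 < i)%N]) \bigcap_(m in [set: int])
      [set x | 1 <= 4 * n.+2%:R * `|(scale i)%:R * x - m%:~R|].
  apply/seteqP; split => x.
    move=> [/andP[x1 x2] h]; split; first by rewrite /= lerN2.
    by move=> i ni m _; exact: h.
  move=> [[/= x1 x2] h]; split; first by rewrite x1 -lerN2.
  by move=> i m ni; exact: h.
have cmul (c : R) : continuous (fun x => c * x).
  by move=> x; apply: cvgM; [exact: cvg_cst|exact: cvg_id].
apply: closedI; first apply: closedI.
- exact: closed_preimage_le (cmul _).
- by apply: closed_preimage_le => x; apply: cvgN; exact: cmul.
apply: closed_bigI => i _; apply: closed_bigI => m _.
apply: closed_preimage_le => x; apply: cvgM; first exact: cvg_cst.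
by apply: cvg_norm; apply: cvgB; [exact: cmul|exact: cvg_cst].
Qed.

Lemma pieces_closed (R : realType) : closed (pieces R).
Proof.
apply: closed_bigI => N _; apply: closedU.
  apply: closed_bigcup; first exact: finite_II.
  by move=> n _; exact: piece_closed.
have -> : [set x : R | 0 <= x /\ 3 * (scale N.*2)%:R * x <= 2] =
    [set x | 0 <= x] `&` [set x | - 2 <= - (3 * (scale N.*2)%:R * x)].
  by apply/seteqP; split => x [/= x0 x1]; split => //=; [rewrite lerN2|rewrite -lerN2].
apply: closedI; apply: closed_preimage_le => x; first exact: cvg_id.
apply: cvgN; apply: cvgM; [exact: cvg_cst|exact: cvg_id].
Qed.

Lemma pieces_compact (R : realType) : compact (pieces R).
Proof.
apply: (subclosed_compact (pieces_closed R) (@segment_compact R 0 1)).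
(* At [N = 0] the union of pieces is empty, and what remains is [0 <= 3 * x <= 2]. *)
move=> x /(_ 0%N I)[[n //]|/= [x0 x1]]; rewrite in_itv /= x0; lra.
Qed.

Lemma piece_bound (R : realType) (N n : nat) (x : R) : (N <= n)%N ->
  piece R n x -> 0 <= x /\ 3 * (scale N.*2)%:R * x <= 2.
Proof.
move=> Nn [/andP[x1 x2] _]; have x0 : 0 <= x.
  have s0 : 0 < 3 * (scale n.*2)%:R :> R by rewrite mulr_gt0 ?scaler_gt0.
  by rewrite -(pmulr_rge0 _ s0); lra.
split => //; apply: le_trans x2; rewrite ler_wpM2r// ler_pM2l// ler_nat.
by apply: scale_mono; rewrite leq_double.
Qed.

Lemma piece_sub_pieces (R : realType) (n : nat) : piece R n `<=` pieces R.
Proof.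
move=> x px N _; have [nN|Nn] := ltnP n N; first by left; exists n.
by right; exact: piece_bound px.
Qed.

Lemma scale_archimedean (R : realType) (e : R) : 0 < e ->
  exists N, 2 < 3 * (scale N.*2)%:R * e.
Proof.
move=> e0; pose N := (Num.truncn (2 / e)).+1; exists N.
have h : 2 / e < N%:R by exact: truncnS_gt.
have h2 : N%:R <= (scale N.*2)%:R :> R.
  by rewrite ler_nat; apply: leq_trans (ltnW (scale_ge _)); rewrite -addnn leq_addr.
move: h; rewrite ltr_pdivrMr// => h.
have := ler_wpM2r (ltW e0) h2; lra.
Qed.

Lemma piecesP (R : realType) (x : R) : pieces R x ->
  x = 0 \/ exists n, piece R n x.
Proof.
move=> px; have [->|x0] := eqVneq x 0; [by left|right].
have {x0} : 0 < x.
  by rewrite lt0r x0; case: (px 0%N I) => [[n //]|[]].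
move=> /scale_archimedean[N hN].
case: (px N I) => [[n _ pnx]|[_ /=]]; first by exists n.
by rewrite leNgt hN.
Qed.

(** * Finiteness of the intersections with translates of the Cantor set *)

(** Base 1 at index [n.*2] puts both scaled points at most 1/8 above integers, so their difference
    is within 1/8 of an integer, whereas [piece] places it in [1/3, 2/3]. *)
Lemma cantor_emb_diff_notin_piece (R : realType) (n : nat) (s s' : cantor_space) :
  ~ piece R n (cantor_emb R s - cantor_emb R s').
Proof.
have [m [e [e0 e1 h]]] := cantor_emb_digit R n.*2 s.
have [m' [e' [e'0 e'1 h']]] := cantor_emb_digit R n.*2 s'.
have := digit_lt n.*2 s; have := digit_lt n.*2 s'.
rewrite base_even !ltnS !leqn0 => /eqP d' /eqP d.
rewrite d base_even !mul0r in h e1; rewrite d' base_even !mul0r in h' e'1.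
move=> [/andP[x1 x2] _].
rewrite -mulrA mulrBr h h' in x1 x2.
have H : 0 < (m - m')%:~R :> R by rewrite intrB; lra.
have H' : (m - m')%:~R < 1%:~R :> R by rewrite intrB; lra.
move: H H'; rewrite ltr_int -[0]/(0%:~R) ltr_int; lia.
Qed.

Lemma circle_cover (R : realType) (N : nat) (z : R) : (0 < N)%N ->
  exists j (m : int), (j < N)%N /\ 0 <= N%:R * (z + j%:R / N%:R - m%:~R) < 1.
Proof.
move=> N0; pose T := Num.floor (N%:R * z).
have N0' : N%:Z != 0 by rewrite eqz_nat -lt0n.
(* This [j] makes [T + j] a multiple of [N]. *)
exists `|(- T %% N%:Z)%Z|%N, (- (- T %/ N%:Z)%Z); split.
  by rewrite -ltz_nat gez0_abs ?modz_ge0// ltz_pmod.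
have -> : (`|(- T %% N%:Z)%Z|%N)%:R = ((- T %% N%:Z)%Z)%:~R :> R.
  by rewrite -[in RHS](gez0_abs (modz_ge0 (- T) N0')).
have N0R : N%:R != 0 :> R by rewrite pnatr_eq0 -lt0n.
have := congr1 (fun k : int => k%:~R : R) (divz_eq (- T) N%:Z).
rewrite intrD intrM intrN /= => E.
have -> : N%:R * (z + (- T %% N%:Z)%Z%:~R / N%:R - (- (- T %/ N%:Z)%Z)%:~R) =
    N%:R * z - T%:~R.
  by rewrite intrN -[in RHS](opprK T%:~R) E -[N%:Z%:~R]/(N%:R); field.
rewrite subr_ge0 floor_le ltrBlDr addrC.
by have := floorD1_gt (N%:R * z); rewrite intrD.
Qed.

Lemma cantor_emb_piece_finite (R : realType) (n : nat) (x : R) :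
  finite_set (translate (range (cantor_emb R : cantor_space -> R)) x `&` piece R n).
Proof.
apply: contrapT => /infiniteP/pcard_leP/injfunPex[v vS vinj].
have /choice[u hu] : forall j : nat, exists s : cantor_space, cantor_emb R s + x = v j.
  by move=> j; have [[_ [s _ <-] <-] _] := vS j I; exists s.
have uinj : injective u.
  by move=> i j uij; apply: vinj; rewrite ?inE // -!hu uij.
(* The first [8 * n.+2] points receive all digits of one base, at an index beyond [n.*2]. *)
have [|i [ni bi di]] := digits_realized (8 * n.+2).-1 n.*2.+1 u.
  by move=> a b _ _; exact: uinj.
have {}bi : base i = (8 * n.+2)%N by rewrite bi prednK// muln_gt0.
have [j [m [jN /andP[c1 c2]]]] := circle_cover R (8 * n.+2) ((scale i)%:R * x) isT.
have [_ /(_ i)] := (vS j I).2.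
have [m' [e [e0 e1 h]]] := cantor_emb_digit R i (u j).
move=> /(_ (m' + m) ni).
have dj : digit i (u j) = j by apply: di; lia.
rewrite -hu (mulrDr (scale i)%:R) h dj bi intrD.
move: c1 c2 e1; rewrite bi natrM.
have : 2 <= n.+2%:R :> R by rewrite ler_nat.
move: n.+2%:R ((scale i)%:R * x) (j%:R / _) => M z a M2 c1 c2 e1.
have -> : m'%:~R + a + e + z - (m'%:~R + m%:~R) = (z + a - m%:~R) + e by ring.
(* Here [d < 1 / (8 * M)] and [e <= 1 / (64 * M)], so [d + e] is below the distance [1 / (4 * M)]
   required by [piece]. *)
move: c1 c2; move: (z + a - _) => d c1 c2.
have d0 : 0 <= d by rewrite -(pmulr_rge0 _ (_ : 0 < 8 * M))//; lra.
rewrite ger0_norm ?addr_ge0//; lra.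
Qed.

Lemma pieces_haar_finite (R : realType) : haar_finite (pieces R).
Proof.
have cf := cantor_emb_continuous R.
set C := range (cantor_emb R : cantor_space -> R).
exists (pieces R), C; split.
- have := @sub_sigma_algebra R setT (@open R).
  move=> /(_ (~` pieces R)) /(_ (closed_openC (pieces_closed R))).
  by move=> /(sigma_algebraC); rewrite setCK.
- by [].
- apply: cantor_set_range cf (@cantor_emb_inj R); exact: norm_hausdorff.
move=> x.
suff [N hN] : exists N, forall n, (N <= n)%N -> forall s : cantor_space,
    ~ piece R n (cantor_emb R s + x).
  apply: (@sub_finite_set _ _ ([set 0] `|`
     \bigcup_(n in `I_N) (translate C x `&` piece R n))).
    move=> _ [[_ [s _ <-] <-] /piecesP[->|[n pn]]]; [by left|right].
    exists n; last by split => //; exists (cantor_emb R s) => //; exists s.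
    by rewrite /= ltnNge; apply/negP => /hN/(_ s).
  rewrite finite_setU; split; first exact: finite_set1.
  apply: bigcup_finite; first exact: finite_II.
  by move=> n _; exact: cantor_emb_piece_finite.
apply: contrapT => /forallNP far.
have {}far N : exists n (s : cantor_space), (N <= n)%N /\ piece R n (cantor_emb R s + x).
  apply: contrapT => /forallNP h; apply: (far N) => n Nn s ps.
  by apply: (h n); exists s.
(* Pieces of large index lie close to 0, so points of [C] come arbitrarily near [- x], and [C] is
   closed. *)
have [s0 hs0] : exists s0 : cantor_space, cantor_emb R s0 = - x.
  have cC : closed C.
    apply: compact_closed; first exact: norm_hausdorff.
    apply: continuous_compact; last exact: cantor_space_compact.
    exact: continuous_subspaceT.
  suff : C (- x) by move=> [s0 _ hs0]; exists s0.
  apply: cC => U /nbhs_ballP[e /= e0 eU].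
  have [N hN] := scale_archimedean R e e0.
  have [n [s [Nn ps]]] := far N.
  exists (cantor_emb R s); split; first by exists s.
  apply: eU; rewrite /ball /= -opprD normrN addrC.
  have [f0 f1] := piece_bound _ _ _ _ Nn ps.
  rewrite ger0_norm//; have s0 := scaler_gt0 R N.*2.
  rewrite -(@ltr_pM2l _ (3 * (scale N.*2)%:R)) ?mulr_gt0//; lra.
have [n [s [_]]] := far 0%N.
by rewrite -[x]opprK -hs0; exact: cantor_emb_diff_notin_piece.
Qed.

(** * Failure of every uniform bound *)

Lemma pieces_not_haar_n (R : realType) (n : nat) : ~ haar_n n (pieces R).
Proof.
move=> [B [C [_ AB [f [g [cf <- fK _]]]]]] /=.
pose s : cantor_space := fun=> false.
have s0 : 0 < 12 * (scale n.*2)%:R :> R by rewrite mulr_gt0 ?scaler_gt0.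
have e0 : 0 < (12 * (scale n.*2)%:R)^-1 :> R by rewrite invr_gt0.
(* The radius is the bound on the [t j] in [piece_universal]. *)
have [z [zinj hz]] := @cantor_space_accumulation R f s _ (cf s) (can_inj fK)
  (nbhsx_ballx (f s) _ e0).
have [j|y hy] := piece_universal R n (fun j => z j - f s).
  have [_] := hz j; rewrite /ball /= distrC -(ltr_pM2l s0) mulfV ?gt_eqF//.
  exact: ltW.
move=> /(_ (y - f s)) le_n.
suff : `I_n.+1 #<= `I_n by rewrite card_le_II ltnn.
apply: card_le_trans le_n.
have winj : {in `I_n.+1 &, injective (fun j => y + (z j - f s))}.
  by move=> i j _ _ /addrI/addIr/zinj.
rewrite -(card_le_eql (inj_card_eq winj)); apply: subset_card_le => _ [j /= jn <-].
split; last by apply/AB/piece_sub_pieces/hy.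
by exists (z j); [exact: (hz j).1|rewrite addrCA].
Qed.

Theorem corollary6p3 (R : realType) :
  exists A : set R,
    compact A /\ haar_finite A /\ forall n : nat, ~ haar_n n A.
Proof.
exists (pieces R); split; first exact: pieces_compact.
split; first exact: pieces_haar_finite.
exact: pieces_not_haar_n.
Qed.
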